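(* Let $\mathcal X_0$ be a Hilbert space and $G$ a self-adjoint, positive and injective operator on $\mathcal X_0$ (possibly unbounded) with dense range. Then there exists a quasi Gelfand triple (of Hilbert spaces) with pivot space $\mathcal X_0$ whose Gram operator is $G$. In particular, denoting the corresponding quasi Gelfand triple by $(\mathcal X_+,\mathcal X_0,\mathcal X_-)$ with embeddings $\iota_+,\iota_-$, we have $$\operatorname{ran}\iota_+=\operatorname{dom}G^{1/2}\quad\text{and}\quad\operatorname{ran}\iota_-=\operatorname{ran}G^{1/2}.$$ Moreover, $G$ coincides with the Gram operator $G_+$ of $(\mathcal X_+,\mathcal X_0,\mathcal X_-)$, i.e. $G=G_+$.
   Context: All spaces are complex; the anti-dual $X'$ of a Banach space $X$ is the space of continuous antilinear functionals on $X$. For Banach spaces $X,Y$ and a continuous sesquilinear form $\langle\cdot,\cdot\rangle_{Y,X}:Y\times X\to\mathbb C$ (linear in the first, antilinear in the second argument), put $\langle x,y\rangle_{X,Y}:=\overline{\langle y,x\rangle_{Y,X}}$. $(X,Y)$ is a complete dual pair if $Y\to X'$, $y\mapsto\langle y,\cdot\rangle_{Y,X}$ and $X\to Y'$, $x\mapsto\langle x,\cdot\rangle_{X,Y}$ are both isometric and bijective. A pre-quasi Gelfand triple $(\mathcal X_+,\mathcal X_0,\mathcal X_-)$ with pivot space $\mathcal X_0$ consists of a complete dual pair $(\mathcal X_+,\mathcal X_-)$, a Hilbert space $\mathcal X_0$ and linear maps $\iota_\pm:\operatorname{dom}\iota_\pm\subseteq\mathcal X_\pm\to\mathcal X_0$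 that are densely defined, closed, injective and have dense range, with $\langle g,f\rangle_{\mathcal X_-,\mathcal X_+}=\langle\iota_-g,\iota_+f\rangle_{\mathcal X_0}$ for all $f\in\operatorname{dom}\iota_+$, $g\in\operatorname{dom}\iota_-$. It is a quasi Gelfand triple if in addition $\operatorname{dom}\iota_+^*=\operatorname{ran}\iota_-$, where $\operatorname{dom}\iota_+^*$ is the set of $h\in\mathcal X_0$ for which $\operatorname{dom}\iota_+\ni f\mapsto\langle h,\iota_+f\rangle_{\mathcal X_0}$ is continuous with respect to $\|\cdot\|_{\mathcal X_+}$. It is ``of Hilbert spaces'' if $\mathcal X_+$ and $\mathcal X_-$ are Hilbert spaces. The Gram operator of a quasi Gelfand triple of Hilbert spaces is $G_+:=(\iota_+^{-1})^{*_{\mathrm h}}\iota_+^{-1}=(\iota_+\iota_+^{*_{\mathrm h}})^{-1}:\operatorname{dom}G_+\subseteq\mathcal X_0\to\mathcal X_0$, where $*_{\mathrm h}$ denotes the usual Hilbert space adjoint with respect to the inner products of $\mathcal X_0$ and $\mathcal X_+$. Positive means $\langle Gf,f\rangle_{\mathcal X_0}\ge0$ for $f\in\operatorname{dom}G$ (not necessarily coercive), and $G^{1/2}$ is the positive self-adjoint square root of $G$. *)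

(* Defs.v *)
From HB Require Import structures.
From mathcomp Require Import all_boot all_order all_algebra.
From mathcomp Require Import complex.
From mathcomp Require Import all_classical all_reals all_analysis.

Set Implicit Arguments.
Unset Strict Implicit.
Unset Printing Implicit Defensive.

Import Order.TTheory GRing.Theory Num.Theory.
Import numFieldNormedType.Exports.

Local Open Scope classical_set_scope.
Local Open Scope complex_scope.
Local Open Scope ring_scope.

(* Sesquilinear forms are linear in the first and antilinear in the second    *)
(* argument, as for MathComp's {dot _ for _}.                                 *)
HB.mixin Record isHilbert (R : realType) X & CompleteNormedModule R[i] X := {
  inner : {dot X for @Num.conj R[i]} ;
  normr_inner : forall x : X, `|x| ^+ 2 = inner x x
}.

#[short(type="hilbertType")]
HB.structure Definition Hilbert (R : realType) :=
  {X of isHilbert R X & CompleteNormedModule R[i] X}.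

Notation "{ 'sesquilinear' Y -> X }" :=
  {bilinear Y -> X -> _ | *%R & @Num.conj _ \; *%R}
  (at level 0, Y at level 98, X at level 99).

Section DualPair.
Variable R : realType.

(* The norm of a functional as an extended real, so that it is meaningful     *)
(* (possibly +oo) for every functional; the norm of a normedModType R[i] takes *)
(* its values in R[i], hence the real part.                                   *)
Definition functional_norm (X : normedModType R[i]) (phi : X -> R[i]) : \bar R :=
  ereal_sup [set (complex.Re `|phi x|)%:E | x in [set x | `|x| <= 1]].

Definition antidual (X : normedModType R[i]) : set (X -> R[i]) :=
  [set phi | linear_for (@Num.conj _ \; *%R) phi
             /\ continuous (phi : X -> R[i]^o)].

Definition isometric_bijection (Y X : normedModType R[i])
    (F : Y -> X -> R[i]) : Prop :=
  set_bij [set: Y] (@antidual X) F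
  /\ forall y, functional_norm (F y) = (complex.Re `|y|)%:E.

Definition flip_pairing (X Y : Type) (p : Y -> X -> R[i]) (x : X) (y : Y) :=
  Num.conj (p y x).

Definition complete_dual_pair (X Y : normedModType R[i])
    (p : {sesquilinear Y -> X}) : Prop :=
  [/\ continuous ((fun yx => p yx.1 yx.2) : Y * X -> R[i]^o),
      isometric_bijection p
    & isometric_bijection (flip_pairing p)].

End DualPair.

Section Operators.
Variable R : realType.

(* A linear operator dom T `<=` X -> Y; the values of [opfun] outside [dom]   *)
(* are irrelevant, so operators are compared through their graphs.            *)
Record operator (X Y : lmodType R[i]) := Operator {
  dom : set X;
  opfun :> X -> Y;
  dom0 : dom 0;
  domP : forall a x y, dom x -> dom y -> dom (a *: x + y);
  opfunP : forall a x y, dom x -> dom y ->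
    opfun (a *: x + y) = a *: opfun x + opfun y
}.

Definition ran (X Y : lmodType R[i]) (T : operator X Y) : set Y := T @` dom T.

Definition graph (X Y : lmodType R[i]) (T : operator X Y) : set (X * Y) :=
  [set (x, T x) | x in dom T].

Definition graph_inv (X Y : Type) (T : set (X * Y)) : set (Y * X) :=
  [set yx | T (yx.2, yx.1)].

Definition graph_comp (X Y Z : Type) (S : set (Y * Z)) (T : set (X * Y)) :
    set (X * Z) :=
  [set xz | exists2 y, T (xz.1, y) & S (y, xz.2)].

(* <T x, h> = <x, k>: the graph of the Hilbert space adjoint, single-valued   *)
(* when the relation [T] has dense domain.                                    *)
Definition graph_adjoint (X Y : hilbertType R) (T : set (X * Y)) :
    set (Y * X) :=
  [set hk | forall x y, T (x, y) -> inner y hk.1 = inner x hk.2].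

Definition self_adjoint (H : hilbertType R) (T : operator H H) : Prop :=
  dense (dom T) /\ graph_adjoint (graph T) = graph T.

Definition positive_operator (H : hilbertType R) (T : operator H H) : Prop :=
  forall f, dom T f -> 0 <= inner (T f) f.

Definition positive_sqrt (H : hilbertType R) (G S : operator H H) : Prop :=
  [/\ self_adjoint S, positive_operator S
    & graph_comp (graph S) (graph S) = graph G].

End Operators.

Section QuasiGelfand.
Variable R : realType.

Definition embedding (X : normedModType R[i]) (X0 : hilbertType R)
    (iota : operator X X0) : Prop :=
  [/\ dense (dom iota), closed (graph iota), set_inj (dom iota) iota
    & dense (ran iota)].

(* The domain of the adjoint into the dual of [X], when [X] is not identified *)
(* with its dual.                                                             *)
Definition dom_adjoint (X : normedModType R[i]) (X0 : hilbertType R)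
    (iota : operator X X0) : set X0 :=
  [set h | {within dom iota, continuous (fun f => inner h (iota f) : R[i]^o)}].

Definition pre_quasi_gelfand_triple
    (Xp : completeNormedModType R[i]) (X0 : hilbertType R)
    (Xm : completeNormedModType R[i]) (p : {sesquilinear Xm -> Xp})
    (iotap : operator Xp X0) (iotam : operator Xm X0) : Prop :=
  [/\ complete_dual_pair p, embedding iotap, embedding iotam
    & forall f g, dom iotap f -> dom iotam g ->
        p g f = inner (iotam g) (iotap f)].

Definition quasi_gelfand_triple
    (Xp : completeNormedModType R[i]) (X0 : hilbertType R)
    (Xm : completeNormedModType R[i]) (p : {sesquilinear Xm -> Xp})
    (iotap : operator Xp X0) (iotam : operator Xm X0) : Prop :=
  pre_quasi_gelfand_triple p iotap iotam /\ dom_adjoint iotap = ran iotam.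

Definition gram_operator (Xp X0 : hilbertType R) (iotap : operator Xp X0) :
    set (X0 * X0) :=
  graph_comp (graph_adjoint (graph_inv (graph iotap)))
             (graph_inv (graph iotap)).

End QuasiGelfand.

(* Main.v *)
Require Import Defs.
From HB Require Import structures.
From mathcomp Require Import all_boot all_order all_algebra.
From mathcomp Require Import ring lra complex.
From mathcomp Require Import all_classical all_reals all_analysis.

Set Implicit Arguments.
Unset Strict Implicit.
Unset Printing Implicit Defensive.

Import Order.TTheory GRing.Theory Num.Theory.
Import numFieldNormedType.Exports.

Local Open Scope classical_set_scope.
Local Open Scope complex_scope.
Local Open Scope ring_scope.

(* Let S be the positive square root of G, and let both spaces of the triple  *)
(* be X0, paired by the inner product, with iota_- = S and iota_+ = S^-1: the *)
(* Gram operator is then S^* S = G, and the duality is the Riesz theorem.     *)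
(*                                                                            *)
(* For the square root, B = (1 + G)^-1 and 1 - B are bounded and positive,    *)
(* with commuting bounded roots P and Q, and S is the operator with graph     *)
(* {(P x, Q x)}. If T is any positive square root of G, then T B is positive, *)
(* commutes with P and Q and squares to (P Q)^2, whence T B = P Q; this gives *)
(* that S extends T, and then T = S by self-adjointness.                      *)

(** Write S for the positive root of G. The natural candidate for the positive space is the
    completion of dom S under the norm [|S f|]. Since S maps dom S isometrically for this norm onto
    the dense subspace ran S, that completion is [X0] itself, and the embedding becomes S^-1. The
    dual embedding is then S, and compatibility with the pairing, [<S g, S^-1 f> = <g, f>], is the
    symmetry of S. The quasi Gelfand condition asks when [S g |-> <h, g>] is bounded on ran S: Riesz
    on that subspace produces [u] with [<u, S g> = <h, g>], and S^* = S turns this into [h = S u]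
    ([dom_adjoint_inverse]). Injectivity and dense range of S come from those of G, because ker S
    lies in ker G and ran G in ran S.

    The root rests on three results: [add_positive_surjective] yields the resolvent,
    [exists_bounded_sqrt] takes bounded roots by iteration, and [quotient_operator_self_adjoint]
    reassembles an unbounded operator from them. The range identities are claimed for every positive
    root, so the uniqueness half of [exists_unique_positive_sqrt] is essential as well. *)

Section HilbertSpace.
Variables (R : realType) (H : hilbertType R).
Implicit Types (x y z : H) (a b : R[i]).

Lemma innerDl x y z : inner (x + y) z = inner x z + inner y z.
Proof. exact: linearDl. Qed.
Lemma innerDr x y z : inner x (y + z) = inner x y + inner x z.
Proof. exact: linearDr. Qed.
Lemma innerNl x y : inner (- x) y = - inner x y.
Proof. exact: linearNl. Qed.
Lemma innerNr x y : inner x (- y) = - inner x y.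
Proof. exact: linearNr. Qed.
Lemma innerBl x y z : inner (x - y) z = inner x z - inner y z.
Proof. exact: linearBl. Qed.
Lemma innerBr x y z : inner x (y - z) = inner x y - inner x z.
Proof. exact: linearBr. Qed.
Lemma innerZl a x y : inner (a *: x) y = a * inner x y.
Proof. exact: linearZl_LR. Qed.
Lemma innerZr a x y : inner x (a *: y) = a^* * inner x y.
Proof. exact: (linearZr_LR (inner : {dot H for @Num.conj R[i]})). Qed.
Lemma inner0l y : inner 0 y = 0 :> R[i].
Proof. exact: linear0l. Qed.
Lemma inner0r x : inner x 0 = 0 :> R[i].
Proof. exact: linear0r. Qed.
Lemma innerC x y : inner x y = (inner y x)^*.
Proof. by rewrite hermC expr0 mul1r. Qed.
Lemma inner_ge0 x : 0 <= inner x x.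
Proof. exact: dnorm_ge0. Qed.
Lemma inner_eq0 x : (inner x x == 0) = (x == 0).
Proof. exact: dnorm_eq0. Qed.

Lemma inner_left_inj x y : (forall z, inner x z = inner y z) -> x = y.
Proof.
move=> e; apply/eqP; rewrite -subr_eq0 -inner_eq0 innerBl e subrr //.
Qed.

Lemma inner_right_inj x y : (forall z, inner z x = inner z y) -> x = y.
Proof. by move=> e; apply: inner_left_inj => z; rewrite innerC e -innerC. Qed.

Lemma CauchySchwarz_inner x y : `|inner x y| <= `|x| * `|y|.
Proof.
have [->|y0] := eqVneq y 0; first by rewrite inner0r normr0 mulr_ge0.
have y_gt0 : 0 < `|y| by rewrite normr_gt0.
(* This is [|y|^2] times the component of [x] orthogonal to [y]. *)
pose z := (`|y| ^+ 2) *: x - inner x y *: y.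
have zE : inner z z = `|y| ^+ 2 * ((`|x| * `|y|) ^+ 2 - `|inner x y| ^+ 2).
  rewrite /z innerBl !innerBr !innerZl !innerZr [inner y x]innerC !normCK.
  rewrite -!normr_inner (@geC0_conj _ (`|y| ^+ 2)) ?exprn_ge0//.
  rewrite exprMn; ring.
have := inner_ge0 z; rewrite zE pmulr_rge0 ?exprn_gt0// subr_ge0.
by rewrite ler_sqr// nnegrE// mulr_ge0.
Qed.

Lemma parallelogram_law x y :
  `|x + y| ^+ 2 + `|x - y| ^+ 2 = 2 * (`|x| ^+ 2 + `|y| ^+ 2).
Proof.
rewrite !normr_inner innerBl innerDl !innerBr !innerDr; ring.
Qed.

End HilbertSpace.

(** * Continuity of the inner product and completeness *)

Section Limits.
Variables (R : realType) (H : hilbertType R).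
Implicit Types (x y z : H) (a b : R[i]).

(** Positive elements of [R[i]] are real, so an epsilon taken in [R[i]] can be traded for one in
    [R]. *)
Lemma complex_gt0_re (e : R[i]) :
  0 < e -> 0 < complex.Re e /\ (complex.Re e)%:C = e.
Proof.
by move=> e0; split; [move: e0; rewrite ltcE => /andP[]|rewrite RRe_real ?gtr0_real].
Qed.

Lemma inner_continuous : continuous (fun xy : H * H => inner xy.1 xy.2 : R[i]^o).
Proof.
move=> -[x0 y0] /=; apply/cvgrPdist_lt => e e0.
pose D := `|x0| + `|y0| + 1.
have D0 : 0 < D by rewrite ltr_wpDl// addr_ge0.
(* Chosen so that [d <= 1] and [d * D < e]; the three error terms are bounded by [d * |y0|],
   [|x0| * d] and [d * 1], which add up to [d * D]. *)
pose d := e / (D + e).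
have De0 : 0 < D + e by rewrite addr_gt0.
have d0 : 0 < d by rewrite divr_gt0.
have d1 : d <= 1 by rewrite ler_pdivrMr// mul1r lerDr ltW.
have dD : d * D < e.
  by rewrite /d mulrAC ltr_pdivrMr// ltr_pM2l// ltrDl.
exists (ball x0 d, ball y0 d) => /=.
  by split; exact: nbhsx_ballx.
move=> [x y] /= []; rewrite -!ball_normE /= => hx hy.
have -> : inner x0 y0 - inner x y =
    inner (x0 - x) y0 + (inner x0 (y0 - y) - inner (x0 - x) (y0 - y)).
  rewrite !innerBl !innerBr; ring.
apply: le_lt_trans dD.
have -> : d * D = `|x0 - x| * 0 + (d * `|y0| + (`|x0| * d + d * 1)).
  by rewrite /D; ring.
rewrite mulr0 add0r (le_trans (ler_normD _ _))// lerD//.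
  rewrite (le_trans (CauchySchwarz_inner _ _))// ler_pM// ltW//.
rewrite (le_trans (ler_normB _ _))// lerD//.
  by rewrite (le_trans (CauchySchwarz_inner _ _))// ler_pM// ltW.
rewrite (le_trans (CauchySchwarz_inner _ _))// ler_pM// ?ltW//.
exact: lt_le_trans hy d1.
Qed.

Lemma cvg_inner (T : Type) (F : set_system T) (FF : Filter F) (u v : T -> H)
    (k l : H) :
  u t @[t --> F] --> k -> v t @[t --> F] --> l ->
  (inner (u t) (v t) : R[i]^o) @[t --> F] --> (inner k l : R[i]^o).
Proof.
move=> uk vl.
apply: (@continuous_cvg _ (H * H)%type _ _ _ (fun t => (u t, v t))
  (fun xy : H * H => inner xy.1 xy.2 : R[i]^o) (k, l)).
  exact: inner_continuous.
exact: (cvg_pair uk vl).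
Qed.

Lemma cauchy_seq_cvg (u : nat -> H) :
  (forall e : R, 0 < e -> exists N, forall m n, (N <= m)%N -> (N <= n)%N ->
    `|u m - u n| < e%:C) ->
  exists l : H, u n @[n --> \oo] --> l.
Proof.
move=> uC; exists (limn u); apply/cauchy_cvgP/cauchy_ballP => e e0.
have [re0 <-] := complex_gt0_re e0.
have [N uN] := uC _ re0.
exists (u @` [set n | (N <= n)%N], u @` [set n | (N <= n)%N]) => /=.
  by split; exists N => //= n Nn; exists n.
by move=> [_ _] [[m /= Nm <-] [n /= Nn <-]]; rewrite -ball_normE /=; exact: uN.
Qed.
End Limits.

(** * Riesz vectors for functionals on a subspace *)

Section Projection.
Variables (R : realType) (H : hilbertType R).
Implicit Types (x y z : H) (a b : R[i]).

(** The norm of [H] takes values in [R[i]]; this real copy allows infima and real arithmetic. *)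
Definition rnorm x : R := complex.Re `|x|.

Lemma rnormE x : (rnorm x)%:C = `|x|.
Proof. by rewrite /rnorm RRe_real// normr_real. Qed.

Lemma rnorm_ge0 x : 0 <= rnorm x.
Proof. by rewrite -lecR rnormE; exact: normr_ge0. Qed.

Lemma rnorm_sqr x : ((rnorm x) ^+ 2)%:C = inner x x.
Proof. by rewrite rmorphXn /= rnormE normr_inner. Qed.

Lemma rnorm_parallelogram x y :
  rnorm (x + y) ^+ 2 + rnorm (x - y) ^+ 2 = 2 * (rnorm x ^+ 2 + rnorm y ^+ 2).
Proof.
apply: (@complexI R); rewrite rmorphM !rmorphD /= !rmorphXn /= !rnormE.
by rewrite parallelogram_law.
Qed.

Lemma rnormZ_real (c : R) x : rnorm (c%:C *: x) = `|c| * rnorm x.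
Proof.
apply: (@complexI R); rewrite rmorphM /= !rnormE normrZ; congr (_ * _).
by rewrite normc_def /= expr0n addr0 sqrtr_sqr.
Qed.

Definition antilinear_on (D : set H) (phi : H -> R[i]) :=
  forall a x y, D x -> D y -> phi (a *: x + y) = a^* * phi x + phi y.

Lemma antilinear_on0 (D : set H) (phi : H -> R[i]) :
  D 0 -> antilinear_on D phi -> phi 0 = 0.
Proof.
move=> D0 philin.
have := philin 1 0 0 D0 D0; rewrite scaler0 addr0 rmorph1 mul1r => /eqP.
by rewrite -subr_eq0 opprD addrA subrr sub0r oppr_eq0 => /eqP.
Qed.

(* The Riesz vector minimises |x|^2 - 2 Re (phi x), and minimising sequences  *)
(* in D are Cauchy by the parallelogram law.                                  *)
Lemma Riesz_subspace (D : set H) (phi : H -> R[i]) (C : R) :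
  D 0 -> (forall a x y, D x -> D y -> D (a *: x + y)) ->
  antilinear_on D phi -> (forall x, D x -> `|phi x| <= C%:C * `|x|) ->
  exists (u : nat -> H) (y : H), [/\ forall n, D (u n),
    u n @[n --> \oo] --> y & forall x, D x -> inner y x = phi x].
Proof.
move=> D0 Dlin philin phiC.
have phi0 := antilinear_on0 D0 philin.
have DZ a x : D x -> D (a *: x) by move=> Dx; rewrite -[_ *: _]addr0; exact: Dlin.
have phiZ a x : D x -> phi (a *: x) = a^* * phi x.
  by move=> Dx; rewrite -[a *: x]addr0 philin// phi0 addr0.
pose q x := rnorm x ^+ 2 - 2 * complex.Re (phi x).
have qE x : (q x)%:C = inner x x - (phi x + (phi x)^*).
  rewrite rmorphB -[X in X - _]/((rnorm x ^+ 2)%:C) rnorm_sqr; congr (_ - _).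
  by rewrite addcJ rmorphM rmorph_nat.
pose E := [set q x | x in D].
have E0 : E !=set0 by exists (q 0), 0.
have Elb : lbound E (- C ^+ 2).
  move=> _ [x Dx <-]; have := phiC x Dx; rewrite -rnormE -rmorphM /= => h.
  have := le_trans (normc_ge_Re (phi x)) h; rewrite lecR => /(le_trans (ler_norm _)).
  rewrite /q; have := sqr_ge0 (rnorm x - C); nra.
have Einf : has_inf E by split=> //; exists (- C ^+ 2).
pose d := inf E.
have dP y : D y -> d <= q y.
  by move=> Dy; apply: ge_inf; [exists (- C ^+ 2)|exists y].
pose r n : R := n.+1%:R^-1.
have r0 n : 0 < r n by rewrite invr_gt0.
have rle m n : (m <= n)%N -> r n <= r m.
  by move=> mn; rewrite lef_pV2 ?posrE// ler_nat ltnS.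
have /choice [u uP] n : exists y, D y /\ q y < d + r n.
  by have [_ [y Dy <-] h] := inf_adherent (r0 n) Einf; exists y.
have uD n : D (u n) by case: (uP n).
have rsmall (e : R) : 0 < e -> exists N, forall n, (N <= n)%N -> r n < e.
  move=> e0; exists (Num.trunc e^-1) => n /rle rn.
  by rewrite (le_lt_trans rn)// -[ltRHS]invrK ltf_pV2 ?posrE ?invr_gt0// truncnS_gt.
(* The left side is [2 q (u m) + 2 q (u n) - 4 q] at the midpoint, and [q] at the midpoint is at
   least [d]. *)
have uC m n : rnorm (u m - u n) ^+ 2 <= 2 * (r m + r n).
  have := rnorm_parallelogram (u m) (u n).
  have Dmn : D ((2^-1)%:C *: (u m + u n)).
    by rewrite scalerDr; apply: Dlin => //; exact: DZ.
  have := dP _ Dmn.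
  have -> : q ((2^-1)%:C *: (u m + u n)) = rnorm (u m + u n) ^+ 2 / 4 -
      (complex.Re (phi (u m)) + complex.Re (phi (u n))).
    rewrite /q rnormZ_real exprMn; congr (_ - _).
      by rewrite ger0_norm ?invr_ge0// mulrC; congr (_ * _); field.
    rewrite phiZ; last by rewrite -[u m]scale1r; exact: Dlin.
    rewrite -[u m in LHS]scale1r philin// rmorph1 mul1r.
    rewrite conj_Creal ?complex_real//.
    by case: (phi (u m)) (phi (u n)) => a b [a' b'] /=; rewrite mul0r subr0; field.
  have [_] := uP m; have [_] := uP n; rewrite /q.
  lra.
have [y uy] : exists y : H, u n @[n --> \oo] --> y.
  apply: cauchy_seq_cvg => e e0.
  have [N rN] := rsmall (e ^+ 2 / 4) ltac:(by rewrite divr_gt0// exprn_gt0).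
  exists N => m n Nm Nn; rewrite -rnormE ltcR.
  rewrite -(@ltr_pXn2r _ 2) ?nnegrE ?rnorm_ge0 ?ltW//.
  have := uC m n; have := rN _ Nm; have := rN _ Nn; lra.
exists u, y; split=> // z Dz.
(* Moving [u n] along [z] by the optimal [c] lowers [q] by [|e|^2 / inner z z], yet [q (u n)] is
   within [r n] of the infimum. *)
have ub n : `|inner (u n) z - phi z| ^+ 2 <= (r n)%:C * `|z| ^+ 2.
  have [->|z0] := eqVneq z 0.
    by rewrite inner0r phi0 subr0 !normr0 expr0n mulr0.
  have z_gt0 : 0 < inner z z by rewrite lt0r inner_ge0 inner_eq0 z0.
  set e := inner (u n) z - phi z; pose c := - e / inner z z.
  have : (q (c *: z + u n))%:C = (q (u n))%:C - `|e| ^+ 2 / inner z z.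
    rewrite !qE philin// innerDl !innerDr !innerZl !innerZr [inner z (u n)]innerC.
    rewrite rmorphD rmorphM /= conjCK normCK.
    have -> : c^* = - e^* / inner z z.
      by rewrite /c fmorph_div rmorphN /= (geC0_conj (inner_ge0 z)).
    rewrite /c.
    have -> : inner (u n) z = e + phi z by rewrite subrK.
    have -> : (e + phi z)^* = e^* + (phi z)^* by exact: rmorphD.
    field; exact: lt0r_neq0.
  have [_ h1] := uP n; have h2 := dP _ (Dlin c _ _ Dz (uD n)).
  move=> h3; have : (q (u n))%:C < (q (c *: z + u n))%:C + (r n)%:C.
    by rewrite -rmorphD ltcR; lra.
  rewrite h3 -addrA ltrDl addrC subr_gt0 -normr_inner => /ltW; rewrite ler_pdivrMr//.
  by rewrite normr_inner.
have h0 : (inner (u n) z - phi z : R[i]^o) @[n --> \oo] -->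
    (inner y z - phi z : R[i]^o).
  by apply: cvgB; [apply: cvg_inner => //; exact: cvg_cst|exact: cvg_cst].
have : (inner (u n) z - phi z : R[i]^o) @[n --> \oo] --> (0 : R[i]^o).
  apply/cvgrPdist_lt => e e0; have [re0 ee] := complex_gt0_re e0.
  pose M := rnorm z ^+ 2 + 1.
  have M0 : 0 < M by rewrite ltr_wpDl// sqr_ge0.
  have [N rN] := rsmall (complex.Re e ^+ 2 / M) ltac:(by rewrite divr_gt0// exprn_gt0).
  exists N => //= n /rN rn.
  rewrite sub0r normrN -(@ltr_pXn2r _ 2) ?nnegrE ?normr_ge0 ?(ltW e0)//.
  apply: (le_lt_trans (ub n)).
  rewrite -ee -rnormE -!rmorphXn -rmorphM /= ltcR.
  move: rn; rewrite ltr_pdivlMr//; apply: le_lt_trans.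
  by rewrite ler_pM2l// lerDl.
by move=> h1; apply/eqP; rewrite -subr_eq0; apply/eqP; apply: (cvg_unique _ h0 h1).
Qed.

End Projection.

(** * Riesz representation and self-duality of a Hilbert space *)

Section Riesz.
Variables (R : realType) (H : hilbertType R).

Lemma antidual_inner (y : H) : antidual (inner y).
Proof.
split; first by move=> a u v; rewrite innerDr innerZr.
move=> x; apply: cvg_inner; [exact: cvg_cst|exact: cvg_id].
Qed.

(** Continuity at 0 gives a radius [d] within which [phi] stays below 1 on [D]; rescaling [x] to
    norm [d / 2] gives the constant [2 / d]. *)
Lemma antilinear_continuous_bounded (D : set H) (phi : H -> R[i]) :
  D 0 -> (forall a x y, D x -> D y -> D (a *: x + y)) -> antilinear_on D phi ->
  {within D, continuous (phi : H -> R[i]^o)} ->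
  exists C : R, forall x, D x -> `|phi x| <= C%:C * `|x|.
Proof.
move=> D0 Dlin philin /subspace_continuousP/(_ 0 D0)/cvgrPdist_lt/(_ 1 ltr01).
have phi0 := antilinear_on0 D0 philin.
rewrite /from_subspace phi0 near_withinE => /nbhs_ballP[d /= d0 dP].
have [re0 dE] := complex_gt0_re d0.
exists (2 / complex.Re d) => x Dx.
have [->|x0] := eqVneq x 0; first by rewrite phi0 !normr0 mulr0.
have nx0 : 0 < `|x| by rewrite normr_gt0.
pose c := d / 2 / `|x|.
have c0 : 0 < c by rewrite !divr_gt0.
have Dcx : D (c *: x) by rewrite -[_ *: _]addr0; exact: Dlin.
have := dP (c *: x); rewrite -ball_normE /= !sub0r !normrN.
have -> : phi (c *: x) = c^* * phi x by rewrite -[_ *: _]addr0 philin// phi0 addr0.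
rewrite normrZ [`|_ * phi x|]normrM norm_conjC (gtr0_norm c0) divfK ?gt_eqF//.
rewrite ltr_pdivrMr// ltr_pMr// ltr1n => /(_ isT Dcx) h.
rewrite -(ler_pM2l c0) (le_trans (ltW h))// rmorphM /= fmorphV /= dE rmorph_nat.
rewrite le_eqVlt; apply/orP; left; apply/eqP; rewrite /c; field.
by rewrite !gt_eqF.
Qed.

Lemma Riesz_representation (phi : H -> R[i]) : antidual phi ->
  exists y, inner y = phi.
Proof.
move=> [philin phicont].
have lin a (x y : H) : [set: H] x -> [set: H] y -> [set: H] (a *: x + y) by [].
have philin' : antilinear_on setT phi by move=> a x y _ _; exact: philin.
have phicont' : {within [set: H], continuous (phi : H -> R[i]^o)}.
  exact: continuous_subspaceT.
have [C phiC] := antilinear_continuous_bounded I lin philin' phicont'.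
have [u [y [_ _ yP]]] := Riesz_subspace I lin philin' phiC.
by exists y; apply/funext => x; exact: yP.
Qed.

Lemma functional_norm_inner (y : H) :
  functional_norm (inner y) = (complex.Re `|y|)%:E.
Proof.
apply/eqP; rewrite eq_le; apply/andP; split.
  apply: ge_ereal_sup => _ [x /= x1 <-]; rewrite lee_fin -lecR.
  rewrite !RRe_real ?normr_real// (le_trans (CauchySchwarz_inner _ _))//.
  by rewrite ler_piMr.
apply: ereal_sup_ubound.
have [->|y0] := eqVneq y 0.
  exists 0; first by rewrite /= normr0 ler01.
  by rewrite inner0r !normr0.
exists (`|y|^-1 *: y); first by rewrite /= normrZ normfV normr_id mulVf ?normr_eq0.
congr (complex.Re _)%:E; rewrite innerZr -normr_inner normrM norm_conjC.
by rewrite normfV normrX !normr_id expr2 mulrA mulVf ?mul1r// normr_eq0.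
Qed.

Lemma isometric_bijection_inner : isometric_bijection (inner : H -> H -> R[i]).
Proof.
split; last exact: functional_norm_inner.
split=> [y _|x y _ _ e|phi /Riesz_representation[y <-]]; last by exists y.
- exact: antidual_inner.
- by apply: inner_left_inj => z; rewrite e.
Qed.

Definition inner_pairing : {sesquilinear H -> H} := @inner R H.

Lemma complete_dual_pair_inner : complete_dual_pair inner_pairing.
Proof.
split; first exact: inner_continuous.
  exact: isometric_bijection_inner.
suff -> : flip_pairing inner_pairing = inner by exact: isometric_bijection_inner.
by apply/funext => x; apply/funext => y; rewrite /flip_pairing [RHS]innerC.
Qed.

End Riesz.

(** * Bounded symmetric operators and their square roots *)

Section SymmetricOperators.
Variables (R : realType) (H : hilbertType R).
Implicit Types (A B C P : H -> H) (x y z : H) (a b : R[i]).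

Lemma cvg_eq_lim (u v : nat -> R[i]^o) (k l : R[i]) : u =1 v ->
  u n @[n --> \oo] --> (k : R[i]^o) -> v n @[n --> \oo] --> (l : R[i]^o) -> k = l.
Proof. by move=> /funext -> h1 h2; apply: (cvg_unique _ h1 h2). Qed.

(** Bounded self-adjoint operators are encoded as bare functions: symmetry on all of [H] already
    forces linearity, and norm bounds are carried as separate hypotheses. *)
Definition symmetric_map A := forall x y, inner (A x) y = inner x (A y).

Lemma symmetric_linear A : symmetric_map A ->
  forall a x y, A (a *: x + y) = a *: A x + A y.
Proof.
move=> As a x y; apply: inner_left_inj => z.
by rewrite As !(innerDl, innerZl) -!As.
Qed.

Lemma symmetricD A x y : symmetric_map A -> A (x + y) = A x + A y.
Proof. by move=> As; have := symmetric_linear As 1 x y; rewrite !scale1r. Qed.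

Lemma symmetricB A x y : symmetric_map A -> A (x - y) = A x - A y.
Proof.
move=> As; have := symmetric_linear As (-1) y x.
by rewrite !scaleN1r addrC => ->; rewrite addrC.
Qed.

Lemma symmetricZ A a x : symmetric_map A -> A (a *: x) = a *: A x.
Proof.
move=> As; have A0 : A 0 = 0 by rewrite -[X in A X](subrr x) symmetricB// subrr.
by rewrite -[a *: x]addr0 symmetric_linear// A0 addr0.
Qed.

Lemma symmetric_comp A B : symmetric_map A -> symmetric_map B ->
  (forall x, A (B x) = B (A x)) -> symmetric_map (A \o B).
Proof. by move=> As Bs AB x y /=; rewrite As Bs -AB. Qed.

Lemma rnormD x y : rnorm (x + y) <= rnorm x + rnorm y.
Proof. by rewrite -lecR rmorphD /= !rnormE ler_normD. Qed.

(** By Cauchy-Schwarz, [<x - P x, x>] is at most [|x|^2]. The contraction bound on [1 - P] is the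
    form of positivity that passes from an operator to its root. *)
Lemma symmetric_ge0 P : symmetric_map P ->
  (forall x, rnorm (x - P x) <= rnorm x) -> forall x, 0 <= inner (P x) x.
Proof.
move=> Ps Pc x.
have rP : inner (x - P x) x \is Num.real.
  apply/CrealP; rewrite -innerC innerBl innerBr Ps //.
have -> : inner (P x) x = `|x| ^+ 2 - inner (x - P x) x.
  by rewrite normr_inner innerBl subKr.
rewrite subr_ge0 (le_trans (real_ler_norm rP))//.
rewrite (le_trans (CauchySchwarz_inner _ _))// expr2 ler_pM//.
by rewrite -!rnormE lecR.
Qed.

(* Y_(n+1) = (A + Y_n^2) / 2 converges to 1 - sqrt(1 - A); its increments    *)
(* are dominated by those of the scalar sequence obtained for A = 1.          *)
Section SquareRootIteration.
Variable A : H -> H.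
Hypotheses (As : symmetric_map A) (Ac : forall x, rnorm (A x) <= rnorm x).

Fixpoint sqrt_iter n : H -> H :=
  if n is m.+1 then fun x => (2^-1)%:C *: (A x + sqrt_iter m (sqrt_iter m x))
  else fun=> 0.

Fixpoint sqrt_bound n : R :=
  if n is m.+1 then (1 + sqrt_bound m ^+ 2) / 2 else 0.

Lemma sqrt_bound_itv n : 0 <= sqrt_bound n <= 1.
Proof. elim: n => [|n /andP[h0 h1]] /=; first by rewrite lexx ler01. nra. Qed.

Lemma sqrt_bound_nondecreasing : nondecreasing_seq sqrt_bound.
Proof.
apply/nondecreasing_seqP; elim=> [|n IHn]; first by have /andP[] := sqrt_bound_itv 1.
have /andP[b0 _] := sqrt_bound_itv n; have /andP[c0 _] := sqrt_bound_itv n.+1.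
rewrite -[sqrt_bound n.+2]/((1 + sqrt_bound n.+1 ^+ 2) / 2).
by rewrite {1}/sqrt_bound -/sqrt_bound ler_pM2r ?invr_gt0// lerD2l ler_sqr.
Qed.

Lemma innerZr_real (c : R) x y : inner x (c%:C *: y) = c%:C * inner x y.
Proof. by rewrite innerZr conj_Creal// complex_real. Qed.

Lemma sqrt_iter_symmetric n : symmetric_map (sqrt_iter n).
Proof.
elim: n => [|n IHn] x y /=; first by rewrite inner0l inner0r.
by rewrite innerZl innerZr_real innerDl innerDr As !IHn.
Qed.

Lemma sqrt_iter_norm n x : rnorm (sqrt_iter n x) <= sqrt_bound n * rnorm x.
Proof.
elim: n x => [|n IHn] x /=; first by rewrite mul0r /rnorm normr0.
rewrite rnormZ_real ger0_norm ?invr_ge0//.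
have := rnormD (A x) (sqrt_iter n (sqrt_iter n x)); have := Ac x.
have := IHn (sqrt_iter n x).
have := ler_wpM2l (proj1 (andP (sqrt_bound_itv n))) (IHn x).
lra.
Qed.

Lemma sqrt_iter_step n x :
  rnorm (sqrt_iter n.+1 x - sqrt_iter n x) <=
  (sqrt_bound n.+1 - sqrt_bound n) * rnorm x.
Proof.
elim: n x => [|n IHn] x.
  rewrite /= !subr0 addr0 rnormZ_real ger0_norm ?invr_ge0// expr0n addr0 mul1r.
  by rewrite ler_pM2l ?invr_gt0.
(* The splitting [Y^2 - Z^2 = Y (Y - Z) + (Y - Z) Z] needs no commutation; on the scalar side it
   gives half of [(b_(n+1) + b_n) (b_(n+1) - b_n)], that is [b_(n+2) - b_(n+1)]. *)
have -> : sqrt_iter n.+2 x - sqrt_iter n.+1 x = (2^-1)%:C *: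
    (sqrt_iter n.+1 (sqrt_iter n.+1 x - sqrt_iter n x) +
     (sqrt_iter n.+1 (sqrt_iter n x) - sqrt_iter n (sqrt_iter n x))).
  rewrite (symmetricB _ _ (sqrt_iter_symmetric n.+1)).
  rewrite addrA subrK [X in X - _]/= [X in _ - X]/= -scalerBr; congr (_ *: _).
  by rewrite opprD addrACA subrr add0r.
rewrite rnormZ_real ger0_norm ?invr_ge0//.
have := rnormD (sqrt_iter n.+1 (sqrt_iter n.+1 x - sqrt_iter n x))
  (sqrt_iter n.+1 (sqrt_iter n x) - sqrt_iter n (sqrt_iter n x)).
have := sqrt_iter_norm n.+1 (sqrt_iter n.+1 x - sqrt_iter n x).
have := IHn (sqrt_iter n x).
have b1 := proj1 (andP (sqrt_bound_itv n.+1)).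
have d0 : 0 <= sqrt_bound n.+1 - sqrt_bound n.
  by rewrite subr_ge0 sqrt_bound_nondecreasing.
have := ler_wpM2l b1 (IHn x); have := ler_wpM2l d0 (sqrt_iter_norm n x).
rewrite [sqrt_bound n.+2]/=.
have -> : sqrt_bound n.+1 = (1 + sqrt_bound n ^+ 2) / 2 by [].
lra.
Qed.

Lemma sqrt_iter_dist m n x : (n <= m)%N ->
  rnorm (sqrt_iter m x - sqrt_iter n x) <=
  (sqrt_bound m - sqrt_bound n) * rnorm x.
Proof.
have dist0 k : rnorm (sqrt_iter k x - sqrt_iter k x) <=
    (sqrt_bound k - sqrt_bound k) * rnorm x.
  by rewrite !subrr mul0r /rnorm normr0.
elim: m => [|m IHm]; first by rewrite leqn0 => /eqP ->.
rewrite leq_eqVlt ltnS => /predU1P[->//|/IHm h].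
rewrite -(subrK (sqrt_iter m x) (sqrt_iter m.+1 x)) -addrA.
have := rnormD (sqrt_iter m.+1 x - sqrt_iter m x) (sqrt_iter m x - sqrt_iter n x).
have := sqrt_iter_step m x.
lra.
Qed.

Lemma sqrt_iter_commute C n : symmetric_map C -> (forall x, C (A x) = A (C x)) ->
  forall x, C (sqrt_iter n x) = sqrt_iter n (C x).
Proof.
move=> Cs CA; elim: n => [|n IHn] x /=.
  by rewrite -[0 in LHS](subrr x) symmetricB// subrr.
by rewrite symmetricZ// symmetricD// CA !IHn.
Qed.

Lemma sqrt_iter_cvg x : exists y : H, sqrt_iter n x @[n --> \oo] --> y.
Proof.
have bc : cvgn sqrt_bound.
  apply: nondecreasing_is_cvgn; first exact: sqrt_bound_nondecreasing.
  by exists 1 => _ [n _ <-]; case/andP: (sqrt_bound_itv n).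
apply: cauchy_seq_cvg => e e0.
have D0 : 0 < rnorm x + 1 by rewrite ltr_wpDl// rnorm_ge0.
have [N _ bN] := (cvgrPdist_lt _ _).1 bc _ (divr_gt0 e0 D0).
suff h m n : (N <= n)%N -> (n <= m)%N -> rnorm (sqrt_iter m x - sqrt_iter n x) < e.
  exists N => m n Nm Nn; rewrite -rnormE ltcR.
  have [mn|/ltnW nm] := leqP n m; first exact: h.
  by rewrite /rnorm distrC; exact: h.
move=> Nn nm; apply: (le_lt_trans (sqrt_iter_dist x nm)).
have := nondecreasing_cvgn_le sqrt_bound_nondecreasing bc m.
have := bN n Nn; rewrite /= ltr_pdivlMr//.
set l := limn _ => h1 h2; move: (ler_norm (l - sqrt_bound n)) => h3.
have := rnorm_ge0 x; have := sqrt_bound_nondecreasing nm.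
nra.
Qed.

End SquareRootIteration.

(** For [A = 1 - B] the limit of the iteration solves [Y = (A + Y^2) / 2], so [P = 1 - Y] satisfies
    [P^2 = 1 - A = B]. Whatever commutes with [B] commutes with every iterate, hence with the
    limit. *)
Lemma exists_bounded_sqrt B : symmetric_map B ->
  (forall x, rnorm (x - B x) <= rnorm x) ->
  exists P, [/\ symmetric_map P, forall x, rnorm (x - P x) <= rnorm x,
    forall x, P (P x) = B x
  & forall C, symmetric_map C -> (forall x, C (B x) = B (C x)) ->
      forall x, C (P x) = P (C x)].
Proof.
move=> Bs Bc; pose A x := x - B x.
have As : symmetric_map A by move=> x y; rewrite /A innerBl innerBr Bs.
have [Y YP] := choice (sqrt_iter_cvg As Bc).
have Ylim x z : (inner (sqrt_iter A n x) z : R[i]^o) @[n --> \oo] -->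
    (inner (Y x) z : R[i]^o).
  by apply: cvg_inner; [exact: YP|exact: cvg_cst].
have Ys : symmetric_map Y.
  move=> x y; apply: (cvg_eq_lim _ (Ylim x y)).
    by move=> n; rewrite sqrt_iter_symmetric.
  by apply: cvg_inner; [exact: cvg_cst|exact: YP].
have Yc x : rnorm (Y x) <= rnorm x.
  apply/ler_addgt0Pr => e e0.
  have e0' : 0 < e%:C :> R[i] by rewrite ltcR.
  have [N _ /(_ N (leqnn N)) /= hN] := (cvgrPdist_lt _ _).1 (YP x) _ e0'.
  rewrite -(subrK (sqrt_iter A N x) (Y x)) (le_trans (rnormD _ _))// addrC lerD//.
    rewrite (le_trans (sqrt_iter_norm (A := A) Bc N x))// ler_piMl ?rnorm_ge0//.
    by case/andP: (sqrt_bound_itv N).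
  by rewrite -lecR rnormE ltW.
(* Symmetry rewrites [<Y_n (Y_n x), z>] as [<Y_n x, Y_n z>], so pointwise convergence is enough to
   pass to the limit. *)
have Yfix x : (2^-1)%:C *: (A x + Y (Y x)) = Y x.
  apply: inner_left_inj => z.
  have := Ylim x z.
  rewrite -(cvg_shiftS (fun n => inner (sqrt_iter A n x) z : R[i]^o)) /=.
  apply: cvg_eq_lim; first by move=> n; rewrite innerZl innerDl sqrt_iter_symmetric.
  rewrite innerZl innerDl Ys; apply: cvgMr; apply: cvgD; first exact: cvg_cst.
  by apply: cvg_inner; exact: YP.
have Ycomm C : symmetric_map C -> (forall x, C (A x) = A (C x)) ->
    forall x, C (Y x) = Y (C x).
  move=> Cs CA x; apply: inner_left_inj => z; rewrite Cs.
  apply: (cvg_eq_lim _ (Ylim x (C z)) (Ylim (C x) z)) => n.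
  by rewrite -Cs sqrt_iter_commute.
exists (fun x => x - Y x); split.
- by move=> x y; rewrite innerBl innerBr Ys.
- by move=> x; rewrite subKr.
- move=> x; rewrite symmetricB//.
  have Y2 : Y x + Y x = A x + Y (Y x).
    rewrite -[in LHS](Yfix x) -mulr2n -scaler_nat scalerA.
    have -> : 2 * (2^-1)%:C = 1 :> R[i] by rewrite fmorphV /= rmorph_nat divff.
    by rewrite scale1r.
  by rewrite opprB addrACA -opprD Y2 /A opprD addrACA subrr addr0 subKr.
- by move=> C Cs CB x; rewrite symmetricB// Ycomm// => {}x; rewrite symmetricB// CB.
Qed.

End SymmetricOperators.

(** * The resolvent of a positive self-adjoint operator *)

Section Resolvent.
Variables (R : realType) (H : hilbertType R).
Implicit Types (T G : operator H H) (x y h k : H).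

(** The inclusion of T^* in T, read as a membership test for [dom T]; limits and Riesz vectors enter
    the domain through it. *)
Lemma self_adjoint_graph T : self_adjoint T -> forall h k,
  (forall x, dom T x -> inner (T x) h = inner x k) -> dom T h /\ T h = k.
Proof.
move=> [_ Tsa] h k hk; have : graph T (h, k).
  by rewrite -Tsa => x y [z Tz [<- <-]]; exact: hk.
by case=> x Tx [<- <-].
Qed.

Lemma self_adjoint_symmetric T : self_adjoint T -> forall x y,
  dom T x -> dom T y -> inner (T x) y = inner x (T y).
Proof.
move=> [_ Tsa] x y Tx Ty.
have : graph T (y, T y) by exists y.
by rewrite -Tsa => /(_ x (T x)); apply; exists x.
Qed.

Lemma opfunB (X Y : lmodType R[i]) (T : operator X Y) (x y : X) :
  dom T x -> dom T y -> dom T (x - y) /\ T (x - y) = T x - T y.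
Proof.
move=> Tx Ty; rewrite -scaleN1r addrC; split; first exact: domP.
by rewrite opfunP// scaleN1r addrC.
Qed.

Variable G : operator H H.
Hypotheses (Gsa : self_adjoint G) (Gpos : positive_operator G).

Lemma inner_add_positive x : dom G x ->
  inner (x + G x) (x + G x) = inner x x + 2 * inner (G x) x + inner (G x) (G x).
Proof.
move=> Gx; rewrite innerDl !innerDr [inner x (G x)]innerC conj_Creal ?ger0_real ?Gpos//.
ring.
Qed.

Lemma rnorm_le x y : inner x x <= inner y y -> rnorm x <= rnorm y.
Proof.
rewrite -!rnorm_sqr lecR => h.
by rewrite -(@ler_pXn2r _ 2) ?nnegrE ?rnorm_ge0.
Qed.

Lemma le_add_positive x : dom G x -> rnorm x <= rnorm (x + G x).
Proof.
move=> Gx; apply: rnorm_le; rewrite inner_add_positive// -addrA lerDl.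
by rewrite addr_ge0 ?inner_ge0// mulr_ge0 ?Gpos.
Qed.

Lemma le_positive_add x : dom G x -> rnorm (G x) <= rnorm (x + G x).
Proof.
move=> Gx; apply: rnorm_le; rewrite inner_add_positive// lerDr.
by rewrite addr_ge0 ?inner_ge0// mulr_ge0 ?Gpos.
Qed.

(** The range of [1 + G] is closed, since [1 + G] is bounded below and [G] is closed. If [z] is the
    projection of [y] onto it, then [y - z] is orthogonal to the range, so [G (y - z) = - (y - z)],
    and positivity forces [y = z]. *)
Lemma add_positive_surjective y : exists2 x, dom G x & x + G x = y.
Proof.
pose M := [set x + G x | x in dom G].
have G0 : G 0 = 0.
  by have [_] := opfunB (dom0 G) (dom0 G); rewrite !subrr.
have M0 : M 0 by exists 0; [exact: dom0|rewrite G0 addr0].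
have Mlin a x z : M x -> M z -> M (a *: x + z).
  move=> [v Gv <-] [w Gw <-]; exists (a *: v + w); first exact: domP.
  by rewrite opfunP// scalerDr addrACA.
have [||u [z [uM uz zP]]] := @Riesz_subspace _ _ M (inner y) (rnorm y) M0 Mlin.
- by move=> a v w _ _; rewrite innerDr innerZr.
- by move=> x _; rewrite rnormE; exact: CauchySchwarz_inner.
have /choice[w wP] n : exists v, dom G v /\ v + G v = u n.
  by have [v Gv <-] := uM n; exists v.
have [v wv] : exists v : H, w n @[n --> \oo] --> v.
  apply: cauchy_seq_cvg => e e0.
  have e2 : 0 < (e / 2)%:C :> R[i] by rewrite ltcR divr_gt0.
  have [N _ uN] := (cvgrPdist_lt _ _).1 uz _ e2.
  exists N => m n Nm Nn; rewrite -rnormE ltcR.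
  have [Gm um] := wP m; have [Gn un] := wP n.
  have [Gmn Gmn'] := opfunB Gm Gn.
  rewrite (le_lt_trans (le_add_positive Gmn))// Gmn' addrACA -opprD um un.
  rewrite -(subrK z (u m)) -addrA (le_lt_trans (rnormD _ _))// [e]splitr.
  have := uN m Nm; have := uN n Nn; rewrite /= -!rnormE !ltcR => h1 h2.
  by rewrite ltrD// /rnorm distrC.
have [Gv Gvz] : dom G v /\ G v = z - v.
  apply: self_adjoint_graph => // x Gx.
  have h1 : (inner (G x) (w n) : R[i]^o) @[n --> \oo] --> (inner (G x) v : R[i]^o).
    by apply: cvg_inner => //; exact: cvg_cst.
  have h2 : (inner x (u n - w n) : R[i]^o) @[n --> \oo] --> (inner x (z - v) : R[i]^o).
    by apply: cvg_inner; [exact: cvg_cst|exact: cvgB].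
  apply: (cvg_eq_lim _ h1 h2) => n; have [Gn <-] := wP n.
  by rewrite addrAC subrr add0r self_adjoint_symmetric.
have zvG : v + G v = z by rewrite Gvz addrC subrK.
exists v => //; rewrite zvG; apply/eqP; rewrite eq_sym -subr_eq0; apply/eqP.
have yzP x : dom G x -> inner (x + G x) (y - z) = 0.
  move=> Gx; rewrite innerC innerBl zP ?subrr ?rmorph0//.
  by exists x.
have [Gyz Gyz'] : dom G (y - z) /\ G (y - z) = - (y - z).
  apply: self_adjoint_graph => // x Gx.
  have := yzP x Gx; rewrite innerDl innerNr addrC => /eqP.
  by rewrite addr_eq0 => /eqP.
have := Gpos Gyz; rewrite Gyz' innerNl oppr_ge0 => h.
by apply/eqP; rewrite -inner_eq0 eq_le h inner_ge0.
Qed.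

Lemma exists_resolvent : exists B : H -> H, [/\ symmetric_map B,
  forall y, dom G (B y) /\ B y + G (B y) = y,
  forall x, dom G x -> B (x + G x) = x,
  forall x, rnorm (B x) <= rnorm x & forall x, rnorm (x - B x) <= rnorm x].
Proof.
have /choice[B BP] y : exists x, dom G x /\ x + G x = y.
  by have [x Gx <-] := add_positive_surjective y; exists x.
exists B; split=> //.
- move=> x y; have [Gx ex] := BP x; have [Gy ey] := BP y.
  rewrite -[in LHS]ey -[in RHS]ex innerDl innerDr self_adjoint_symmetric//.
- move=> x Gx; apply/eqP; rewrite -subr_eq0.
  have [Gx' ex'] := BP (x + G x); have [Gd ed] := opfunB Gx' Gx.
  have := le_add_positive Gd; rewrite ed addrACA -opprD ex' subrr.
  rewrite -lecR !rnormE normr0 => h; rewrite -normr_eq0 eq_le h.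
  exact: normr_ge0.
- by move=> x; have [Gx ex] := BP x; rewrite -{2}ex le_add_positive.
- move=> x; have [Gx ex] := BP x.
  by rewrite -{1 3}ex addrAC subrr add0r le_positive_add.
Qed.

End Resolvent.

(** * Operators given by their graphs *)

Section OperatorOfGraph.
Variables (R : realType) (X Y : lmodType R[i]) (T : set (X * Y)).
Hypotheses (T0 : T (0, 0))
  (Tlin : forall (a : R[i]) x y x' y', T (x, y) -> T (x', y') ->
     T (a *: x + x', a *: y + y'))
  (Tfun : forall x y y', T (x, y) -> T (x, y') -> y = y').

Let domT : set X := [set x | exists y, T (x, y)].
Let funT (x : X) : Y := xget 0 [set y | T (x, y)].

Let funTP x y : T (x, y) -> funT x = y.
Proof. by move=> Txy; apply: xget_unique => // y' /Tfun; exact. Qed.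

Let domT0 : domT 0. Proof. by exists 0. Qed.

Let domTP a x y : domT x -> domT y -> domT (a *: x + y).
Proof. by move=> [x' Tx] [y' Ty]; exists (a *: x' + y'); exact: Tlin. Qed.

Let funT_lin a x y : domT x -> domT y ->
  funT (a *: x + y) = a *: funT x + funT y.
Proof.
move=> [x' Tx] [y' Ty]; rewrite (funTP Tx) (funTP Ty); apply: funTP.
exact: Tlin.
Qed.

Definition operator_of_graph : operator X Y := Operator domT0 domTP funT_lin.

Lemma graph_operator_of_graph : graph operator_of_graph = T.
Proof.
apply/seteqP; split=> [_ [x [y Txy] <-] /=|[x y] Txy]; first by rewrite (funTP Txy).
by exists x; [exists y|rewrite /= (funTP Txy)].
Qed.

End OperatorOfGraph.

Section Graphs.
Variable R : realType.

Lemma graphP (X Y : lmodType R[i]) (T : operator X Y) x y :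
  graph T (x, y) <-> dom T x /\ T x = y.
Proof. by split=> [[z Tz [<- <-]]|[Tx <-]]; [|exists x]. Qed.

Lemma dom_graph (X Y : lmodType R[i]) (T : operator X Y) :
  dom T = [set x | exists y, graph T (x, y)].
Proof.
apply/seteqP; split=> [x Tx|x [y /graphP[]//]].
by exists (T x); exact/graphP.
Qed.

Lemma ran_graph (X Y : lmodType R[i]) (T : operator X Y) :
  ran T = [set y | exists x, graph T (x, y)].
Proof.
apply/seteqP; split=> [_ [x Tx <-]|y [x /graphP[Tx <-]]]; last by exists x.
by exists x; exact/graphP.
Qed.

Lemma dense_subset (X : topologicalType) (A B : set X) :
  A `<=` B -> dense A -> dense B.
Proof. by move=> AB dA O O0 Oo; have [x [Ox /AB]] := dA O O0 Oo; exists x. Qed.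

End Graphs.

(* The operator Q / P for a commuting pair with P^2 + Q^2 = 1: its graph      *)
(* {(P x, Q x)} is also {(h, k) | Q h = P k}, the inverse parametrisation     *)
(* being x = P h + Q k.                                                       *)
Section Quotient.
Variables (R : realType) (H : hilbertType R) (P Q : H -> H).
Hypotheses (Ps : symmetric_map P) (Qs : symmetric_map Q)
  (PQ : forall x, P (Q x) = Q (P x)) (PQ1 : forall x, P (P x) + Q (Q x) = x)
  (Pinj : injective P).

Definition quotient_graph : set (H * H) := [set hk | Q hk.1 = P hk.2].

Lemma quotient_graphP h k : quotient_graph (h, k) <-> exists x, h = P x /\ k = Q x.
Proof.
split=> [/= e|[x [-> ->]]]; last by rewrite /quotient_graph /= PQ.
exists (P h + Q k); rewrite !symmetricD//; split.
  by rewrite PQ -e PQ1.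
by rewrite -PQ e PQ1.
Qed.

Let quotient_graph0 : quotient_graph (0, 0).
Proof.
by apply/quotient_graphP; exists 0; rewrite -[X in P X](subrr 0) -[X in Q X](subrr 0)
  !symmetricB// !subrr.
Qed.

Let quotient_graph_lin (a : R[i]) x y x' y' :
  quotient_graph (x, y) -> quotient_graph (x', y') ->
  quotient_graph (a *: x + x', a *: y + y').
Proof.
by rewrite /quotient_graph /= !symmetric_linear// => -> ->.
Qed.

Let quotient_graph_fun x y y' :
  quotient_graph (x, y) -> quotient_graph (x, y') -> y = y'.
Proof. by rewrite /quotient_graph /= => -> /Pinj. Qed.

Definition quotient_operator : operator H H :=
  operator_of_graph quotient_graph0 quotient_graph_lin quotient_graph_fun.

Lemma graph_quotient_operator : graph quotient_operator = quotient_graph.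
Proof. exact: graph_operator_of_graph. Qed.

(** Testing the adjoint relation on [(P x, Q x)] and moving [P] and [Q] across gives exactly
    [Q h = P k], the equation of the graph itself. *)
Lemma quotient_operator_self_adjoint :
  dense (range P) -> self_adjoint quotient_operator.
Proof.
move=> dP; split.
  apply: dense_subset dP => _ [x _ <-]; rewrite dom_graph graph_quotient_operator.
  by exists (Q x); apply/quotient_graphP; exists x.
rewrite graph_quotient_operator; apply/seteqP; split=> -[h k] /=.
  move=> hk; apply: inner_right_inj => x.
  have /hk /= : quotient_graph (P x, Q x) by apply/quotient_graphP; exists x.
  by rewrite Ps Qs.
move=> /quotient_graphP[u [-> ->]] x y /quotient_graphP[v [-> ->]] /=.
by rewrite Qs -PQ -Ps.
Qed.

Lemma quotient_operator_positive : (forall x, 0 <= inner (P (Q x)) x) ->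
  positive_operator quotient_operator.
Proof.
move=> PQ0 h Dh; have : graph quotient_operator (h, quotient_operator h).
  by exists h.
rewrite graph_quotient_operator => /quotient_graphP[x [-> ->]].
by rewrite -Ps.
Qed.

(** Two pairs [(P x, Q x)] and [(P y, Q y)] compose when [Q x = P y]; then [u = P x + Q y] satisfies
    [P u = x] and [Q u = y]. *)
Lemma quotient_graph_sqr :
  graph_comp quotient_graph quotient_graph = [set (P (P x), Q (Q x)) | x in setT].
Proof.
apply/seteqP; split=> [[h k] /= [m]|_ [x _ <-]].
  move=> /quotient_graphP[x /= [-> ->]] /quotient_graphP[y /= [e ->]].
  have Px : P (P x + Q y) = x by rewrite symmetricD// PQ -e PQ1.
  have Qy : Q (P x + Q y) = y by rewrite symmetricD// -PQ e PQ1.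
  by exists (P x + Q y); rewrite ?Px ?Qy.
exists (P (Q x)); first by apply/quotient_graphP; exists (P x); rewrite /= PQ.
by apply/quotient_graphP; exists (Q x).
Qed.

End Quotient.

(** * Existence and uniqueness of the positive square root *)

Section PositiveSquareRoot.
Variables (R : realType) (H : hilbertType R).

Lemma symmetric_positive_ker (K : H -> H) : symmetric_map K ->
  (forall x, 0 <= inner (K x) x) -> forall y, inner (K y) y = 0 -> K y = 0.
Proof.
move=> Ks Kp y Ky0; apply/eqP; rewrite -inner_eq0; apply/negPn/negP => Ky.
set z := K y in Ky.
have z0 : 0 < inner z z by rewrite lt0r inner_ge0 Ky.
pose m := inner (K z) z; have m0 : 0 <= m := Kp z.
have mz0 : 0 < m + inner z z by rewrite ltr_wpDl.
(* The form of [K] at [y - t z] is [t^2 m - 2 t <z, z>], which this [t] makes negative even when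
   [m = 0]. *)
pose t := inner z z / (m + inner z z).
have t0 : 0 < t by rewrite divr_gt0.
have := Kp ((- t) *: z + y).
rewrite symmetric_linear// innerDl !innerDr !innerZl !innerZr -/z Ky0 addr0.
have -> : (- t)^* = - t by rewrite conj_Creal// rpredN gtr0_real.
have -> : inner (K z) y = inner z z by rewrite Ks.
have -> : - t * (- t * inner (K z) z) + - t * inner z z + - t * inner z z =
   - (t * (inner z z * (m + 2 * inner z z) / (m + inner z z))).
  by rewrite -/m /t; field; exact: lt0r_neq0.
rewrite oppr_ge0 => h.
suff /lt_le_trans/(_ h) :
  0 < t * (inner z z * (m + 2 * inner z z) / (m + inner z z)).
  by rewrite ltxx.
by rewrite mulr_gt0// divr_gt0// mulr_gt0// ltr_wpDl// mulr_gt0.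
Qed.

(** For [y = K x - L x], commutation gives [(K + L) y = K^2 x - L^2 x = 0], so both forms vanish at
    [y] and [K y = L y = 0]; then [<y, y> = <x, K y - L y> = 0]. *)
Lemma symmetric_positive_sqrt_unique (K L : H -> H) :
  symmetric_map K -> symmetric_map L ->
  (forall x, 0 <= inner (K x) x) -> (forall x, 0 <= inner (L x) x) ->
  (forall x, K (L x) = L (K x)) -> (forall x, K (K x) = L (L x)) -> K =1 L.
Proof.
move=> Ks Ls Kp Lp KL KKLL x; apply/eqP; rewrite -subr_eq0.
set y := K x - L x.
have KLy : K y + L y = 0.
  by rewrite /y (symmetricB _ _ Ks) (symmetricB _ _ Ls) KL KKLL addrA subrK subrr.
have : inner (K y) y + inner (L y) y = 0 by rewrite -innerDl KLy inner0l.
move=> /eqP; rewrite paddr_eq0// => /andP[/eqP Ky /eqP Ly].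
rewrite -inner_eq0 {1}/y innerBl Ks Ls.
by rewrite (symmetric_positive_ker Ks Kp Ky) (symmetric_positive_ker Ls Lp Ly) subrr.
Qed.

Variable G : operator H H.
Hypotheses (Gsa : self_adjoint G) (Gpos : positive_operator G).

Section Commutation.
Variables (B : H -> H) (S : operator H H).
Hypotheses (BP : forall y, dom G (B y) /\ B y + G (B y) = y)
  (BK : forall x, dom G x -> B (x + G x) = x) (sqrtS : positive_sqrt G S).

Lemma sqrt_dom x : dom G x -> [/\ dom S x, dom S (S x) & S (S x) = G x].
Proof.
case: sqrtS => _ _ SG Gx; have : graph G (x, G x) by exists x.
by rewrite -SG => -[y /graphP[Sx /= <-] /graphP[SSx /=]].
Qed.

Lemma dom_sqrt x : dom S x -> dom S (S x) -> dom G x /\ G x = S (S x).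
Proof.
case: sqrtS => _ _ SG Sx SSx; apply/graphP; rewrite -SG.
by exists (S x); apply/graphP.
Qed.

(** With [w = B f], [G w = f - w] lies in [dom S], so [S w] lies in [dom G] and
    [S w + G (S w) = S f]; apply [B]. *)
Lemma sqrt_resolvent f : dom S f -> B (S f) = S (B f).
Proof.
move=> Sf; have [Gw wf] := BP f; set w := B f in Gw wf *.
have [Sw SSw SSwE] := sqrt_dom Gw.
have GwE : G w = f - w by rewrite -wf addrC addKr.
have [Sfw SfwE] := opfunB Sf Sw.
have SSSw : dom S (S (S w)) by rewrite SSwE GwE.
have [GSw GSwE] := dom_sqrt SSw SSSw.
have -> : S f = S w + G (S w) by rewrite GSwE SSwE GwE SfwE addrC subrK.
exact: BK.
Qed.

Lemma sqrt_resolvent_symmetric : symmetric_map (S \o B).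
Proof.
have [Ssa _ _] := sqrtS.
move=> x y /=; have [Gx ex] := BP x; have [Gy ey] := BP y.
have [Sx SSx SSxE] := sqrt_dom Gx; have [Sy SSy SSyE] := sqrt_dom Gy.
rewrite -[in LHS]ey -[in RHS]ex innerDl innerDr; congr (_ + _).
  exact: self_adjoint_symmetric.
by rewrite -SSxE -SSyE (self_adjoint_symmetric Ssa SSx SSy).
Qed.

(** With [w = B x] and [x = w + S (S w)], this is [<S w, w> + <S (S w), S w>]. *)
Lemma sqrt_resolvent_ge0 x : 0 <= inner (S (B x)) x.
Proof.
have [Ssa Spos _] := sqrtS.
have [Gx ex] := BP x; have [Sx SSx SSxE] := sqrt_dom Gx.
rewrite -[X in inner _ X]ex innerDr addr_ge0 ?Spos//.
by rewrite -SSxE -self_adjoint_symmetric// Spos.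
Qed.

End Commutation.

Lemma exists_unique_positive_sqrt : exists S : operator H H,
  positive_sqrt G S /\
  forall S' : operator H H, positive_sqrt G S' -> graph S' = graph S.
Proof.
have [B [Bs BP BK Bc Bc']] := exists_resolvent Gsa Gpos.
have [P [Ps Pc PP Pcomm]] := exists_bounded_sqrt Bs Bc'.
pose B' x := x - B x.
have B's : symmetric_map B' by move=> x y; rewrite /B' innerBl innerBr Bs.
have B'c x : rnorm (x - B' x) <= rnorm x by rewrite /B' subKr.
have [Q [Qs Qc QQ Qcomm]] := exists_bounded_sqrt B's B'c.
(* The root of [P] serves the positivity of [P Q]: [<P Q x, x> = <Q (P2 x), P2 x>]. *)
have [P2 [P2s _ P2P2 P2comm]] := exists_bounded_sqrt Ps Pc.
have PB x : P (B x) = B (P x) by rewrite -!PP.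
have PQ x : P (Q x) = Q (P x).
  by apply: Qcomm => // {}x; rewrite /B' symmetricB// PB.
have PQ1 x : P (P x) + Q (Q x) = x by rewrite PP QQ /B' addrC subrK.
have Pinj : injective P.
  move=> x y Pxy; have [_ ex] := BP x; have [_ ey] := BP y.
  by rewrite -ex -ey -!PP Pxy.
have PQ0 x : 0 <= inner (P (Q x)) x.
  rewrite -P2P2 P2s -(P2comm _ Qs); last by move=> y; rewrite PQ.
  exact: symmetric_ge0.
have dP : dense (range P).
  apply: dense_subset (proj1 Gsa) => x Gx.
  by exists (P (x + G x)) => //; rewrite PP BK.
have GB x : G (B x) = B' x.
  by have [_ e] := BP x; rewrite /B' -[X in X - _]e addrC addKr.
pose S := quotient_operator Ps Qs PQ PQ1 Pinj.
have Ssa : self_adjoint S by exact: quotient_operator_self_adjoint.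
exists S; split; first split=> //.
- exact: quotient_operator_positive.
- rewrite graph_quotient_operator quotient_graph_sqr//.
  apply/seteqP; split=> [_ [x _ <-]|[x y] /graphP[Gx <-]].
    by apply/graphP; rewrite PP QQ -GB; have [] := BP x.
  by exists (x + G x) => //; rewrite PP QQ /B' BK// addrC addKr.
move=> T sqrtT.
have Tsub x y : graph T (x, y) -> graph S (x, y).
  move=> /graphP[Tx <-]; rewrite graph_quotient_operator /quotient_graph /=.
  (* Defined on all of [H], because the values of [B] lie in [dom G], hence in [dom T]. *)
  pose K := T \o B.
  have Ks : symmetric_map K := sqrt_resolvent_symmetric BP sqrtT.
  have TB : forall f, dom T f -> B (T f) = T (B f) := sqrt_resolvent BP BK sqrtT.
  have TdB f : dom T (B f) by have [/(sqrt_dom sqrtT)[]] := BP f.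
  have KB f : K (B f) = B (K f) by rewrite /K /= TB.
  have KP f : K (P f) = P (K f) by exact: Pcomm.
  have KQ f : K (Q f) = Q (K f).
    by apply: Qcomm => // {}f; rewrite /B' symmetricB// KB.
  have KPQ : K =1 P \o Q.
    apply: symmetric_positive_sqrt_unique => //=.
    - exact: symmetric_comp.
    - exact: sqrt_resolvent_ge0.
    - by move=> f; rewrite KP KQ.
    - move=> f; rewrite -[Q (P (Q f))]PQ PP QQ /B' symmetricB//.
      rewrite /K /= TB//.
      have [GBf _] := BP (B f).
      by have [_ _ ->] := sqrt_dom sqrtT GBf; rewrite GB.
  (* After applying [P], the claim is [P (Q x) = T (B x) = B (T x) = P (P (T x))]. *)
  apply: (Pinj); have := KPQ x; rewrite /K /= => <-.
  by rewrite -TB// -PP.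
apply/seteqP; split=> -[x y]; first exact: Tsub.
(* Adjoints reverse inclusions: S = S^* is contained in T^* = T. *)
case: Ssa => _ SE; rewrite -SE => xy.
apply/graphP; apply: self_adjoint_graph; first by case: sqrtT.
by move=> z Tz; apply: xy; apply: Tsub; apply/graphP.
Qed.

End PositiveSquareRoot.

(** * The triple with embeddings S^-1 and S *)

Section Triple.
Variable R : realType.

Lemma closed_graph_adjoint (X Y : hilbertType R) (T : set (X * Y)) :
  closed (graph_adjoint T).
Proof.
have -> : graph_adjoint T = \bigcap_(xy in T)
    (fun hk : Y * X => inner xy.2 hk.1 - inner xy.1 hk.2 : R[i]^o) @^-1` [set 0].
  apply/seteqP; split=> [hk hkT [x y] Txy|hk hkT x y Txy] /=.
    by rewrite (hkT x y)// subrr.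
  by apply/eqP; rewrite -subr_eq0; apply/eqP; exact: (hkT (x, y)).
apply: closed_bigI => -[x y] _; apply: preimage_closed; last first.
  by apply: accessible_closed_set1; apply: hausdorff_accessible; exact: norm_hausdorff.
move=> [h k] _; apply: cvgB; apply: cvg_inner; try exact: cvg_cst.
  exact: cvg_fst.
exact: cvg_snd.
Qed.

Lemma closed_graph_inv (X Y : topologicalType) (T : set (X * Y)) :
  closed T -> closed (graph_inv T).
Proof.
move=> cT; apply: (@preimage_closed _ _ (fun yx : Y * X => (yx.2, yx.1))) cT.
by move=> [y x] _; apply: cvg_pair; [exact: cvg_snd|exact: cvg_fst].
Qed.

Section Inverse.
Variables (X Y : lmodType R[i]) (T : operator X Y) (Tinj : set_inj (dom T) T).

Let inv0 : graph_inv (graph T) (0, 0).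
Proof.
have T00 := opfunB (dom0 T) (dom0 T).
by apply/graphP; split; [exact: dom0|move: T00; rewrite !subrr => -[]].
Qed.

Let inv_lin (a : R[i]) x y x' y' :
  graph_inv (graph T) (x, y) -> graph_inv (graph T) (x', y') ->
  graph_inv (graph T) (a *: x + x', a *: y + y').
Proof.
move=> /graphP[/= Ty <-] /graphP[/= Ty' <-]; apply/graphP => /=.
by split; [exact: domP|exact: opfunP].
Qed.

Let inv_fun x y y' :
  graph_inv (graph T) (x, y) -> graph_inv (graph T) (x, y') -> y = y'.
Proof.
move=> /graphP[/= Ty <-] /graphP[/= Ty' e]; apply: Tinj; rewrite ?inE//.
Qed.

Definition inverse_operator : operator Y X := operator_of_graph inv0 inv_lin inv_fun.

Lemma graph_inverse_operator : graph inverse_operator = graph_inv (graph T).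
Proof. exact: graph_operator_of_graph. Qed.

Lemma dom_inverse_operator : dom inverse_operator = ran T.
Proof. by rewrite dom_graph graph_inverse_operator ran_graph. Qed.

Lemma ran_inverse_operator : ran inverse_operator = dom T.
Proof. by rewrite ran_graph graph_inverse_operator dom_graph. Qed.

Lemma inverse_operatorK x : dom T x -> inverse_operator (T x) = x.
Proof.
move=> Tx; suff /graphP[] : graph inverse_operator (T x, x) by [].
by rewrite graph_inverse_operator; exact/graphP.
Qed.

End Inverse.

(** A Riesz vector [u] of the bounded functional on ran S satisfies [<u, S g> = <h, g>], so [u] is
    in [dom S] with [S u = h]. Conversely, for [h = S u] the functional is the restriction of
    [inner u]. *)
Lemma dom_adjoint_inverse (H : hilbertType R) (S : operator H H)
    (Sinj : set_inj (dom S) S) : self_adjoint S ->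
  dom_adjoint (inverse_operator Sinj) = ran S.
Proof.
move=> Ssa; set V := inverse_operator Sinj.
apply/seteqP; split=> [h hV|_ [u Su <-]].
  have Vlin : antilinear_on (dom V) (fun f => inner h (V f)).
    by move=> a x y Vx Vy; rewrite opfunP// innerDr innerZr.
  have [C VC] := antilinear_continuous_bounded (dom0 V) (@domP _ _ _ V) Vlin hV.
  have [_ [u [_ _ uP]]] := Riesz_subspace (dom0 V) (@domP _ _ _ V) Vlin VC.
  have [Su uh] : dom S u /\ S u = h.
    apply: self_adjoint_graph => // g Sg.
    rewrite innerC uP; last by rewrite dom_inverse_operator; exists g.
    by rewrite inverse_operatorK// -innerC.
  by exists u.
have : {within dom V, continuous (inner u : H -> R[i]^o)}.
  by apply: continuous_subspaceT; case: (antidual_inner u).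
apply: subspace_eq_continuous => f; rewrite inE dom_inverse_operator => -[g Sg <-].
by rewrite /from_subspace inverse_operatorK// self_adjoint_symmetric.
Qed.

Lemma embedding_self_adjoint (H : hilbertType R) (S : operator H H) :
  self_adjoint S -> set_inj (dom S) S -> dense (ran S) -> embedding S.
Proof.
move=> [dS SE] Sinj dR; split=> //.
by rewrite -SE; exact: closed_graph_adjoint.
Qed.

Lemma embedding_inverse (H : hilbertType R) (S : operator H H)
    (Sinj : set_inj (dom S) S) :
  embedding S -> embedding (inverse_operator Sinj).
Proof.
case=> dS cS _ dR; split; rewrite ?dom_inverse_operator ?ran_inverse_operator//.
  by rewrite graph_inverse_operator; exact: closed_graph_inv.
move=> _ _ /set_mem[x Sx <-] /set_mem[y Sy <-].
by rewrite !inverse_operatorK// => ->.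
Qed.

End Triple.

Theorem theorem6p5 (R : realType) (X0 : hilbertType R) (G : operator X0 X0)
    (Gsa : self_adjoint G) (Gpos : positive_operator G)
    (Ginj : set_inj (dom G) G) (Gran : dense (ran G)) :
  exists (Xp Xm : hilbertType R) (p : {sesquilinear Xm -> Xp})
         (iotap : operator Xp X0) (iotam : operator Xm X0),
    [/\ quasi_gelfand_triple p iotap iotam,
        gram_operator iotap = graph G,
        exists S : operator X0 X0, positive_sqrt G S
      & forall S : operator X0 X0, positive_sqrt G S ->
          ran iotap = dom S /\ ran iotam = ran S].
Proof.
have [S [sqrtS Suniq]] := exists_unique_positive_sqrt Gsa Gpos.
have [Ssa Spos SG] := sqrtS.
(* A vector killed by [S] is in [dom G] and killed by [G], as [G] is [S] applied twice. *)
have Sinj : set_inj (dom S) S.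
  move=> x y; rewrite !inE => Sx Sy Sxy.
  have [Sd Sde] := opfunB Sx Sy.
  have [_ S0] := opfunB Sx Sx; rewrite !subrr in S0.
  have [_ G0] := opfunB (dom0 G) (dom0 G); rewrite !subrr in G0.
  rewrite Sxy subrr in Sde.
  have SSd : dom S (S (x - y)) by rewrite Sde; exact: dom0.
  have [Gd Gde] := dom_sqrt sqrtS Sd SSd.
  apply/eqP; rewrite -subr_eq0; apply/eqP; apply: Ginj; rewrite ?inE//.
    exact: dom0.
  by rewrite Gde Sde S0 G0.
have Sran : dense (ran S).
  apply: dense_subset Gran => _ [x Gx <-].
  by have [_ SSx <-] := sqrt_dom sqrtS Gx; exists (S x).
have Semb := embedding_self_adjoint Ssa Sinj Sran.
exists X0, X0, (inner_pairing X0), (inverse_operator Sinj), S; split.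
- split; last exact: dom_adjoint_inverse.
  split=> //; first exact: complete_dual_pair_inner.
    exact: embedding_inverse.
  move=> y g; rewrite dom_inverse_operator => -[f Sf <-] Sg.
  by rewrite inverse_operatorK// self_adjoint_symmetric.
(* Inverting the embedding gives back [S], so the Gram operator is S^* S, which is [S] composed with
   itself. *)
- rewrite /gram_operator graph_inverse_operator.
  have -> : graph_inv (graph_inv (graph S)) = graph S by apply/seteqP; split=> -[].
  by rewrite (proj2 Ssa).
- by exists S.
- move=> T /Suniq TS.
  by rewrite ran_inverse_operator dom_graph [ran S]ran_graph -TS -dom_graph -ran_graph.
Qed.
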